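(* Let $\mathcal G$ be a weighted directed graph on $n$ agents with Laplacian matrix $L=(L_{ij})$, and let $h>0$. Consider the multi-agent system with input saturation and event-triggered control protocol $$\dot x_i(t)=\mathrm{sat}_h(\hat u_i(t)),\qquad \hat u_i(t)=-\sum_{j=1}^n L_{ij}\,x_j\big(t^j_{k_j(t)}\big),\qquad i=1,\dots,n,\ t\ge 0,$$ with states $x_i(t)\in\mathbb R^p$, where $\{t^j_k\}_{k\ge1}$ is the increasing triggering time sequence of agent $v_j$ and $k_j(t)=\operatorname{argmax}_k\{t^j_k\le t\}$. Suppose that $\mathcal G$ is strongly connected. Given constants $\alpha_i>0$, $\beta_i>0$ and the first triggering time $t^i_1=0$ for each $i$, let agent $v_i$ determine its triggering times $\{t^i_k\}_{k=2}^\infty$ by $$t^i_{k+1}=\max_{r\ge t^i_k}\Big\{r:\ \|e_i(t)\|^2\le \alpha_i e^{-\beta_i t},\ \forall t\in[t^i_k,r]\Big\},$$ where $e_i(t)=x_i(t^i_k)-x_i(t)$ is the measurement error relative to the latest triggering time $t^i_k$. Then: (i) there is no Zeno behavior, i.e., each agent has only finitely many triggering times in any finite time interval; (ii) global consensus is achieved, i.e., for every initial condition $(x_1(0),\dots,x_n(0))\in(\mathbb R^p)^n$, $\lim_{t\to\infty}(x_i(t)-x_j(t))=0$ for all $i,j\in\{1,\dots,n\}$.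
   Context: Weighted digraph: $\mathcal G=(\mathcal V,\mathcal E,\mathcal A)$ with agents $\mathcal V=\{v_1,\dots,v_n\}$, links $\mathcal E\subseteq\mathcal V\times\mathcal V$, and weighted adjacency matrix $\mathcal A=(a_{ij})$ with $a_{ij}\ge 0$ and $a_{ii}=0$. One has $(v_i,v_j)\in\mathcal E\iff a_{ij}>0$, and this means there is a directed link from $v_j$ to $v_i$ (agent $v_j$ can send information to $v_i$). Laplacian: $L=D-\mathcal A$ with $D=\mathrm{diag}(\sum_j a_{1j},\dots,\sum_j a_{nj})$; that is, $L_{ij}=-a_{ij}$ for $i\ne j$ and $L_{ii}=\sum_{j}a_{ij}$. Strongly connected: for any two distinct agents $v_i,v_j$ there is a directed path from $v_i$ to $v_j$ (a sequence of distinct agents beginning with $v_i$ and ending with $v_j$ with a directed link from each agent to the next). Saturation function: for a constant $h>0$ and scalar $s$, $\mathrm{sat}_h(s)=h$ if $s\ge h$, $\mathrm{sat}_h(s)=s$ if $|s|<h$, $\mathrm{sat}_h(s)=-h$ if $s\le -h$; for vectors it is applied componentwise. $\|\cdot\|$ is the Euclidean norm. The control $\hat u_i$ is piecewise constant: it changes only at triggering times, and states $x_i$ are continuous in $t$. If the set of $r$ in the triggering rule is unbounded (the inequality holds for all $t\ge t^i_k$), agent $v_i$ has no further triggering times after $t^i_k$. *)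

(* Defs.v *)
From HB Require Import structures.
From mathcomp Require Import all_boot all_order all_algebra.
From mathcomp Require Import all_classical all_reals all_analysis.

Set Implicit Arguments.
Unset Strict Implicit.
Unset Printing Implicit Defensive.

Import Order.TTheory GRing.Theory Num.Theory.
Import numFieldNormedType.Exports.

Local Open Scope classical_set_scope.
Local Open Scope ring_scope.

Section Graph.
Variables (R : realType) (n : nat).
Implicit Type A : 'M[R]_n.

(* A weighted digraph on the agents 'I_n is given by its adjacency matrix; its
   links are exactly the pairs of positive weight. *)
Definition weighted_adjacency A : Prop :=
  (forall i j, 0 <= A i j) /\ (forall i, A i i = 0).

Definition laplacian A : 'M[R]_n := diag_mx (\row_i \sum_j A i j) - A.

(* Beware of the orientation: the weight a_ij belongs to the link from j to i. *)
Definition link A : rel 'I_n := fun i j => 0 < A j i.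

Definition strongly_connected A : Prop :=
  forall i j : 'I_n, i != j ->
    exists s : seq 'I_n, [/\ path (link A) i s, last i s = j & uniq (i :: s)].

End Graph.

Section ClosedLoop.
Variables (R : realType) (n p : nat).

Definition sat (h s : R) : R :=
  if h <= s then h else if `|s| < h then s else - h.

(* The library norm on row vectors is the sup norm, hence this definition. *)
Definition enorm (v : 'rV[R]_p) : R := Num.sqrt (\sum_c v 0 c ^+ 2).

(* T k is the (k+1)-st triggering time of an agent (numbering starts at 0
   instead of 1); T k = +oo means that there are at most k triggering times. *)
Definition is_last_trigger (T : nat -> \bar R) (t : R) (k : nat) : Prop :=
  (T k <= t%:E)%E /\ forall l, (T l <= t%:E)%E -> (l <= k)%N.

Definition admissible (a b : R) (y : R -> 'rV[R]_p) (s : R) : set R :=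
  [set r | s <= r /\ forall t, s <= t <= r ->
    enorm (y s - y t) ^+ 2 <= a * expR (- b * t)].

Definition is_next_trigger (S : set R) (u : \bar R) : Prop :=
  (exists2 r, u = r%:E & S r /\ ubound S r) \/ (u = +oo%E /\ ~ has_ubound S).

Definition event_rule (a b : R) (y : R -> 'rV[R]_p) (T : nat -> \bar R) : Prop :=
  [/\ T 0%N = 0%E,
      forall k s, T k = s%:E -> is_next_trigger (admissible a b y s) (T k.+1)
    & forall k, T k = +oo%E -> T k.+1 = +oo%E].

(* k j is meant to be the index of the latest triggering time of agent j. *)
Definition control (A : 'M[R]_n) (x : 'I_n -> R -> 'rV[R]_p)
    (T : 'I_n -> nat -> \bar R) (k : 'I_n -> nat) (i : 'I_n) : 'rV[R]_p :=
  - \sum_j laplacian A i j *: x j (fine (T j (k j))).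

(* The differential equation is imposed at every non-triggering time t for
   which the latest triggering times are defined, i.e., as long as no
   triggering sequence has accumulated before t; in particular no hypothesis
   rules out Zeno behavior. At triggering times the right-hand side jumps, and
   only continuity of the state is required. *)
Record closed_loop (A : 'M[R]_n) (h : R) (alpha beta : 'I_n -> R)
    (x0 : 'I_n -> 'rV[R]_p) (x : 'I_n -> R -> 'rV[R]_p)
    (T : 'I_n -> nat -> \bar R) : Prop := ClosedLoop {
  cl_init : forall i, x i 0 = x0 i;
  cl_continuous : forall i, {within `[0, +oo[, continuous (x i)};
  cl_ode : forall (t : R) (k : 'I_n -> nat), 0 < t ->
    (forall j, is_last_trigger (T j) t (k j)) ->
    (forall j l, T j l <> t%:E) ->
    forall i, is_derive t 1 (x i) (map_mx (sat h) (control A x T k i));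
  cl_event : forall i, event_rule (alpha i) (beta i) (x i) (T i)
}.

Definition no_Zeno (T : 'I_n -> nat -> \bar R) : Prop :=
  forall i (a b : R), finite_set [set k | (a%:E <= T i k <= b%:E)%E].

Definition consensus (x : 'I_n -> R -> 'rV[R]_p) : Prop :=
  forall i j, x i t - x j t @[t --> +oo] --> (0 : 'rV[R]_p).

End ClosedLoop.

(* Main.v *)
Require Import Defs.
From mathcomp Require Import all_boot all_order all_algebra.
From mathcomp Require Import all_classical all_reals all_analysis.
From mathcomp Require Import ring lra.

Set Implicit Arguments.
Unset Strict Implicit.
Unset Printing Implicit Defensive.

Import Order.TTheory GRing.Theory Num.Theory.
Import numFieldNormedType.Exports.

Local Open Scope classical_set_scope.
Local Open Scope ring_scope.

(** No Zeno behavior. The right-hand side of the dynamics is saturated, so every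
    coordinate of every state moves with speed at most h, whatever the sampled
    values are. An agent triggers only when its squared error, which is zero at
    the preceding trigger, has grown to alpha_i exp (- beta_i t); on a bounded time interval
    this threshold is bounded below, hence so is the time between two triggers
    ([trigger_gap]). The differential equation is available only before the
    first accumulation point of triggering times, so the gap estimate is applied
    to an agent whose triggering times have the smallest supremum: none of its
    triggers is preceded by an accumulation ([no_accumulation]).

    Consensus. Once triggers do not accumulate, the sampled states differ from
    the true ones by an error with exponential decay, and the coordinates
    decouple: each one is a scalar system y_i' = sat (u_i + error) with
    u = - L y. The analysis of that system ([saturated_consensus]) is a Lyapunov
    argument. Let xi be the positive left kernel vector of L, which exists by
    strong connectivity ([laplacian_left_kernel]), and let Phi be the primitive
    of sat ([sat_potential]). Up to the integrable error,
    V = sum_i xi_i Phi (u_i) decreases at the rate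
      1/2 sum_ij xi_i a_ij (sat u_i - sat u_j)^2
    ([laplacian_dirichlet]), because u_i' = - sum_j L_ij sat u_j. As V is
    nonnegative and sat u_i - sat u_j is Lipschitz, the latter tends to 0 along
    each link ([dissipation_vanishes]), hence for all i and j. Since
    sum_i xi_i u_i = xi L y = 0, the u_i cannot all have the same sign, so that
    all sat u_i, and then all u_i, tend to 0. Finally y_i - y_j is a fixed
    linear combination of the coordinates of L y = - u, the kernel of L being
    spanned by the constant vector ([laplacian_diff]). *)

(** * Increments, dissipation and limits of finite sums *)

(** The mean value inequality survives finitely many points without a derivative:
    cut the interval at these points. They will be the triggering times, where
    the velocity jumps. *)
Lemma increment_le_finite (R : realType) (f : R -> R) (c : R) (F : seq R)
    (a b : R) :
  a <= b -> {within `[a, b], continuous f} ->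
  (forall t, a < t < b -> t \notin F ->
    exists2 d, is_derive t 1 f d & d <= c) ->
  f b - f a <= c * (b - a).
Proof.
elim: F a b => [|z F IH] a b ab fc fd.
  have [->|anb] := eqVneq a b; first by rewrite !subrr mulr0.
  have {anb ab}ab : a < b by rewrite lt_neqAle anb.
  have [|d dab ->] := @MVT R f (derive1 f) a b ab _ fc.
    move=> t; rewrite in_itv/= => /fd/(_ isT)[d fd' _].
    by rewrite derive1E (@derive_val _ _ _ _ _ _ _ fd').
  apply: ler_wpM2r; first by rewrite subr_ge0 ltW.
  move: dab; rewrite in_itv/= => /fd/(_ isT)[e fd' ec].
  by rewrite derive1E (@derive_val _ _ _ _ _ _ _ fd').
have [zab|zab] := boolP (a < z < b).
  have /andP[az zb] := zab.
  have -> : f b - f a = (f b - f z) + (f z - f a) by ring.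
  have -> : c * (b - a) = c * (b - z) + c * (z - a) by ring.
  apply: lerD; apply: IH.
  - exact: ltW.
  - by apply: continuous_subspaceW fc; apply: subset_itvr; rewrite bnd_simp ltW.
  - move=> t /andP[zt tb] tF; apply: fd; first by rewrite (lt_trans az).
    by rewrite inE negb_or tF andbT gt_eqF.
  - exact: ltW.
  - by apply: continuous_subspaceW fc; apply: subset_itvl; rewrite bnd_simp ltW.
  - move=> t /andP[zt tb] tF; apply: fd; first by rewrite zt (lt_trans tb).
    by rewrite inE negb_or tF andbT lt_eqF.
apply: IH => // t tab tF; apply: fd => //.
rewrite inE negb_or tF andbT; apply: contra zab => /eqP <-; exact: tab.
Qed.

Lemma lipschitz_finite (R : realType) (f : R -> R) (c : R) (F : seq R)
    (a b : R) :
  a <= b -> {within `[a, b], continuous f} ->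
  (forall t, a < t < b -> t \notin F ->
    exists2 d, is_derive t 1 f d & `|d| <= c) ->
  `|f b - f a| <= c * (b - a).
Proof.
move=> ab fc fd; rewrite ler_norml lerNl opprB; apply/andP; split.
  have := @increment_le_finite R (\- f) c F a b ab.
  rewrite /= opprK addrC; apply; first by move=> t; exact: continuousN (fc t).
  move=> t tab tF; have [d fd' dc] := fd t tab tF; exists (- d).
    exact: is_deriveN.
  by rewrite (le_trans (ler_norm _))// normrN.
apply: increment_le_finite ab fc _ => t tab tF.
have [d fd' dc] := fd t tab tF; exists d => //.
by rewrite (le_trans (ler_norm _)).
Qed.

(** A variant of Barbalat's lemma. If `|g| >= e at arbitrarily late times, then
    `|g| >= e / 2 on intervals of fixed length e / (2 l) by the Lipschitz bound,
    and each of them costs U a fixed amount, which U >= 0 cannot afford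
    infinitely often. Stating the decay of U on increments rather than on
    derivatives keeps this independent of where U is differentiable; the case
    c = 0 says that U is nonincreasing. *)
Lemma dissipation_vanishes (R : realType) (U g : R -> R) (k l : R) :
  0 < k -> 0 < l ->
  (forall t, 0 <= t -> 0 <= U t) ->
  (forall s t, 0 <= s -> s <= t -> `|g t - g s| <= l * (t - s)) ->
  (forall s t c, 0 <= s -> s <= t -> 0 <= c ->
    (forall r, s <= r <= t -> c <= `|g r|) ->
    U t - U s <= - (k * c ^+ 2) * (t - s)) ->
  g t @[t --> +oo] --> (0 : R).
Proof.
move=> k0 l0 U0 glip Udec; apply: contrapT => ncvg.
have [e e0 often] : exists2 e, 0 < e & forall M, exists2 t, M < t & e <= `|g t|.
  apply: contrapT => nex; apply: ncvg; apply/cvgrPdist_lt => e e0.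
  apply: contrapT => nnear; apply: nex; exists e => // M.
  apply: contrapT => nt; apply: nnear; exists M; split; first exact: num_real.
  move=> t Mt; rewrite sub0r normrN ltNge; apply/negP => et; apply: nt.
  by exists t.
pose d := e / (2 * l); pose q := k * (e / 2) ^+ 2 * d.
have d0 : 0 < d by rewrite divr_gt0// mulr_gt0.
have q0 : 0 < q by rewrite mulr_gt0// mulr_gt0// exprn_gt0 ?divr_gt0.
have drop m : exists2 t, 0 <= t & U t <= U 0 - q *+ m.
  elim: m => [|m [t t0 Ut]]; first by exists 0; rewrite ?mulr0n ?subr0.
  have [s ts es] := often t; have s0 : 0 <= s by rewrite (le_trans t0) ?ltW.
  have sd : s <= s + d by rewrite lerDl ltW.
  exists (s + d); first exact: le_trans sd.
  have Us : U s - U t <= 0.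
    have := Udec t s 0 t0 (ltW ts) (lexx _) (fun r _ => normr_ge0 _).
    by rewrite expr0n mulr0 oppr0 mul0r.
  have Usd : U (s + d) - U s <= - q.
    have -> : - q = - (k * (e / 2) ^+ 2) * (s + d - s) by rewrite /q; ring.
    apply: Udec => //; first by rewrite divr_ge0 ?ltW.
    move=> r /andP[sr rs].
    have : `|g r - g s| <= e / 2.
      apply: (le_trans (glip _ _ s0 sr)).
      have -> : e / 2 = l * d by rewrite /d; field; rewrite gt_eqF.
      by rewrite ler_pM2l// lerBlDl.
    have := lerB_dist (g s) (g r); rewrite [`|g s - _|]distrC => H1 H2.
    by lra.
  by rewrite mulrSr; lra.
have [t t0] := drop (Num.bound (U 0 / q)).
have := U0 t t0.
have : U 0 / q < (Num.bound (U 0 / q))%:R.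
  by apply: archi_boundP; rewrite divr_ge0 ?U0// ltW.
by rewrite ltr_pdivrMr// mulr_natl; lra.
Qed.

Lemma is_derive_lincomb (R : realType) n (c : 'I_n -> R) (f : 'I_n -> R -> R)
    (df : 'I_n -> R) (t : R) :
  (forall i, is_derive t 1 (f i) (df i)) ->
  is_derive t 1 (fun s => \sum_i c i * f i s) (\sum_i c i * df i).
Proof.
move=> fd.
have -> : (fun s => \sum_i c i * f i s) = \sum_i (c i *: f i).
  by apply/funext => s; rewrite fct_sumE.
by apply: is_derive_sum.
Qed.

Lemma cvg_lincomb (R : realType) (S : Type) (F : set_system S) n (c : 'I_n -> R)
    (f : 'I_n -> S -> R) (l : 'I_n -> R) : Filter F ->
  (forall i, f i t @[t --> F] --> l i) ->
  \sum_i c i * f i t @[t --> F] --> \sum_i c i * l i.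
Proof.
move=> FF fl; apply: cvg_big => [|i _]; first exact: add_continuous.
by apply: cvgM => //; exact: cvg_cst.
Qed.

Lemma within_continuous_coord (R : realType) p (y : R -> 'rV[R]_p) (D : set R) c :
  {within D, continuous y} -> {within D, continuous (fun t => y t 0 c)}.
Proof.
move=> yc t; apply: (@continuous_comp (subspace D) _ _ y (fun v => v 0 c) t (yc t)).
exact: coord_continuous.
Qed.

Lemma cvg_row0 (R : realType) (S : Type) (F : set_system S) p (f : S -> 'rV[R]_p) :
  Filter F -> (forall c, f t 0 c @[t --> F] --> (0 : R)) ->
  f t @[t --> F] --> (0 : 'rV[R]_p).
Proof.
move=> FF fc.
rewrite (_ : f = fun t => \sum_c f t 0 c *: delta_mx 0 c); last first.
  by apply/funext => t; rewrite -row_sum_delta.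
rewrite [X in _ --> X](_ : _ = \sum_(c < p) (0 : R) *: delta_mx 0 c); last first.
  by rewrite big1// => c _; rewrite scale0r.
apply: cvg_big => [|c _]; first exact: add_continuous.
exact: (cvgZr_tmp (fc c)).
Qed.

(** * The saturation function and its potential *)

Lemma normr_sat_le (R : realType) (h s : R) : 0 < h -> `|sat h s| <= h.
Proof.
move=> h0; rewrite /sat; case: ifPn => [_|_]; first by rewrite gtr0_norm.
by case: ifPn => [/ltW//|_]; rewrite normrN gtr0_norm.
Qed.

Lemma sat_cases (R : realType) (h s : R) : 0 < h ->
  [\/ h <= s /\ sat h s = h, - h < s < h /\ sat h s = s | s <= - h /\ sat h s = - h].
Proof.
move=> h0; rewrite /sat; have [hs|sh] := leP h s; first by constructor 1.
have [|] := ltP `|s| h; first by rewrite ltr_norml sh => ->; constructor 2.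
rewrite ler_normr => /orP[|]; first by rewrite leNgt sh.
by rewrite lerNr => ?; constructor 3.
Qed.

Lemma sat_lipschitz (R : realType) (h a b : R) : 0 < h ->
  `|sat h b - sat h a| <= `|b - a|.
Proof.
move=> h0; rewrite ler_norml lerNl !ler_normr.
case: (sat_cases a h0) => -[? ->]; case: (sat_cases b h0) => -[? ->];
have [?|?] := leP a b; apply/andP; split; apply/orP; try (by left; lra); right; lra.
Qed.

(** The primitive of sat that vanishes at 0. Written this way it is the maximum
    of s * y - y ^+ 2 / 2 over `|y| <= h, attained at y = sat h s; its
    derivative then comes out of inequalities, uniformly in s. *)
Definition sat_potential (R : realType) (h s : R) : R :=
  s * sat h s - sat h s ^+ 2 / 2.

Lemma sat_potential_ge0 (R : realType) (h s : R) : 0 < h -> 0 <= sat_potential h s.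
Proof.
move=> h0; rewrite /sat_potential.
by case: (sat_cases s h0) => -[? ->]; nra.
Qed.

(** sat h s is the projection of s on [- h, h]. *)
Lemma sat_variational (R : realType) (h s y : R) : 0 < h -> `|y| <= h ->
  0 <= (sat h s - y) * (s - sat h s).
Proof.
by move=> h0; rewrite ler_norml => yh; case: (sat_cases s h0) => -[? ->]; nra.
Qed.

(** With u = sat h a and v = sat h b the difference is
    (v - u) * (b - (u + v) / 2), which the variational inequalities at a and b
    and the Lipschitz bound place between 0 and (b - a) ^+ 2. *)
Lemma sat_potential_taylor (R : realType) (h a b : R) : 0 < h ->
  `|sat_potential h b - sat_potential h a - sat h a * (b - a)| <= (b - a) ^+ 2.
Proof.
move=> h0; rewrite /sat_potential ler_norml.
have va := sat_variational a h0 (normr_sat_le b h0).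
have vb := sat_variational b h0 (normr_sat_le a h0).
have lip : (sat h b - sat h a) * (b - a) <= (b - a) ^+ 2.
  rewrite (le_trans (ler_norm _))// normrM -[leRHS]real_normK ?num_real// expr2.
  by rewrite ler_wpM2r// sat_lipschitz.
move: (sat h a) (sat h b) va vb lip => u v va vb lip.
have u0 := sqr_ge0 (v - u); have d0 := sqr_ge0 (b - a).
by apply/andP; split; lra.
Qed.

Lemma is_derive_sat_potential (R : realType) (h : R) (s : R) : 0 < h ->
  is_derive s 1 (sat_potential h) (sat h s).
Proof.
move=> h0.
have H : (fun k : R => k^-1 *:
    ((sat_potential h \o shift s) (k *: 1) - sat_potential h s))
    @ (0 : R)^' --> sat h s.
  apply/cvgrPdist_le => e e0; near=> k.
  have k0 : k != 0 by near: k; exact: nbhs_dnbhs_neq.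
  have ke : `|k| <= e by near: k; apply: dnbhs0_le.
  have := sat_potential_taylor s (k + s) h0.
  rewrite addrK => T.
  rewrite /= /shift/= [k *: 1]mulr1.
  have -> : sat h s - k^-1 *: (sat_potential h (k + s) - sat_potential h s)
    = - (k^-1 * (sat_potential h (k + s) - sat_potential h s - sat h s * k)).
    by rewrite /GRing.scale/=; field.
  rewrite normrN normrM normfV mulrC ler_pdivrMr ?normr_gt0//.
  apply: (le_trans T); rewrite -real_normK ?num_real// expr2.
  by rewrite ler_wpM2r.
split; first by apply/cvg_ex; exists (sat h s).
exact/cvg_lim.
Unshelve. all: by end_near. Qed.

Lemma sat_mulr_gt0 (R : realType) (h a s : R) : 0 < h ->
  0 < a * sat h s -> 0 < a * s.
Proof.
move=> h0; case: (sat_cases s h0) => -[sh ->] //.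
  by rewrite !pmulr_lgt0// ?(lt_le_trans h0).
by rewrite mulrN -mulNr pmulr_lgt0// => a0; rewrite -mulrNN mulr_gt0//; lra.
Qed.

(** * Laplacians of strongly connected digraphs *)

Section Laplacian.
Variables (R : realType) (n : nat) (A : 'M[R]_n).

Lemma laplacian_mul (v : 'I_n -> R) i :
  \sum_j laplacian A i j * v j = \sum_j A i j * (v i - v j).
Proof.
under [RHS]eq_bigr do rewrite mulrBr.
rewrite sumrB -mulr_suml.
under eq_bigr do rewrite /laplacian !mxE mulrBl.
rewrite sumrB; congr (_ - _).
rewrite (bigD1 i)//= eqxx mulr1n [X in _ + X]big1 ?addr0// => j ji.
by rewrite eq_sym (negPf ji) mulr0n mul0r.
Qed.

(** Strong connectivity is used only in this form: a property of pairs of agents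
    spreads from the links to all pairs by transitivity. *)
Lemma strongly_connected_ind (P : 'I_n -> 'I_n -> Prop) :
  strongly_connected A -> (forall i, P i i) ->
  (forall j i k, P i j -> P j k -> P i k) ->
  (forall i j, link A i j -> P i j) -> forall i j, P i j.
Proof.
move=> sc Prefl Ptrans Plink i j; have [<-//|ij] := eqVneq i j.
have [s [+ <- _]] := sc i j ij; elim: s i {ij} => //= k s IH i /andP[ik ks].
exact: Ptrans (Plink _ _ ik) (IH _ ks).
Qed.

Hypotheses (A0 : forall i j, 0 <= A i j) (sc : strongly_connected A).

Lemma laplacian_row_sum i : \sum_j laplacian A i j = 0.
Proof.
have := laplacian_mul (fun=> 1) i.
under eq_bigr do rewrite mulr1.
by move=> ->; rewrite big1// => j _; rewrite subrr mulr0.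
Qed.

(** L has zero row sums, hence is singular and has a nonzero left kernel vector v.
    By the triangle inequality the entries of - `|v| L are nonnegative; they add
    up to 0, so `|v| is in the left kernel too. A zero of `|v| would spread
    along the links, by the kernel equations, and make v vanish. *)
Lemma laplacian_left_kernel : exists2 xi : 'I_n -> R,
  forall i, 0 < xi i & forall j, \sum_i xi i * laplacian A i j = 0.
Proof.
case: (posnP n) => [n0|n0].
  by exists (fun=> 0) => i; have := ltn_ord i; rewrite [X in (_ < X)%N]n0.
have : \det (laplacian A)^T = 0.
  apply/eqP/det0P; exists (const_mx 1).
    apply/eqP => /rowP/(_ (Ordinal n0)); rewrite !mxE => /eqP.
    by rewrite oner_eq0.
  apply/rowP => i; rewrite !mxE -[RHS](laplacian_row_sum i).
  by apply: eq_bigr => j _; rewrite !mxE mul1r.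
rewrite det_tr => /eqP/det0P[v v0 vL].
have kerv j : \sum_i v 0 i * laplacian A i j = 0.
  by have /rowP/(_ j) := vL; rewrite !mxE.
have lapE (w : 'I_n -> R) j : \sum_i w i * laplacian A i j =
    w j * (\sum_i A j i) - \sum_i w i * A i j.
  under eq_bigr do rewrite /laplacian !mxE mulrBr.
  rewrite sumrB; congr (_ - _); rewrite (bigD1 j)//= eqxx mulr1n.
  rewrite [X in _ + X]big1 ?addr0//.
  by move=> i ij; rewrite (negPf ij) mulr0n mulr0.
have sub j : 0 <= - \sum_i `|v 0 i| * laplacian A i j.
  rewrite lapE opprB subr_ge0 -[X in _ * X]ger0_norm ?sumr_ge0// -normrM.
  have := kerv j; rewrite lapE => /eqP; rewrite subr_eq0 => /eqP ->.
  apply: (le_trans (ler_norm_sum _ _ _)); apply: ler_sum => i _.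
  by rewrite normrM (ger0_norm (A0 _ _)).
have ker j : \sum_i `|v 0 i| * laplacian A i j = 0.
  apply/eqP; rewrite -oppr_eq0; apply/eqP.
  apply: (@psumr_eq0P _ _ predT _ (fun j _ => sub j)) => //.
  rewrite sumrN exchange_big/=; apply/eqP; rewrite oppr_eq0; apply/eqP.
  by apply: big1 => i _; rewrite -mulr_sumr laplacian_row_sum mulr0.
exists (fun i => `|v 0 i|) => // i; rewrite lt_neqAle normr_ge0 andbT eq_sym.
apply: contra v0 => vi; apply/eqP/rowP => j; rewrite mxE.
apply/eqP; rewrite -normr_eq0; move: i j vi.
apply: strongly_connected_ind => //; first by move=> j i k ij jk /ij/jk.
move=> i j ij /eqP vi; have := ker i; rewrite lapE vi mul0r sub0r => /eqP.
rewrite oppr_eq0 => /eqP/(psumr_eq0P (fun k _ => mulr_ge0 (normr_ge0 _) (A0 _ _))).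
by move=> /(_ j isT)/eqP; rewrite mulf_eq0 (gt_eqF ij) orbF.
Qed.

(** Write s_i (s_i - s_j) as half of (s_i - s_j) ^+ 2 plus half of
    s_i ^+ 2 - s_j ^+ 2; the second part sums to xi L (s ^+ 2) = 0. *)
Lemma laplacian_dirichlet (xi s : 'I_n -> R) :
  (forall j, \sum_i xi i * laplacian A i j = 0) ->
  \sum_i xi i * s i * (\sum_j laplacian A i j * s j) =
  2^-1 * \sum_i \sum_j xi i * A i j * (s i - s j) ^+ 2.
Proof.
move=> xiL.
have zero : \sum_i \sum_j xi i * A i j * (s i ^+ 2 - s j ^+ 2) = 0.
  transitivity (\sum_i xi i * \sum_j laplacian A i j * s j ^+ 2).
    apply: eq_bigr => i _; rewrite (laplacian_mul (fun j => s j ^+ 2)) mulr_sumr.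
    by apply: eq_bigr => j _; rewrite mulrA.
  under eq_bigr do rewrite mulr_sumr.
  rewrite exchange_big big1//= => j _.
  under eq_bigr do rewrite mulrA.
  by rewrite -mulr_suml xiL mul0r.
transitivity (2^-1 * (\sum_i \sum_j xi i * A i j * (s i - s j) ^+ 2 +
  \sum_i \sum_j xi i * A i j * (s i ^+ 2 - s j ^+ 2))); last by rewrite zero addr0.
rewrite -big_split mulr_sumr; apply: eq_bigr => i _.
rewrite laplacian_mul -big_split/= !mulr_sumr.
by apply: eq_bigr => j _; field.
Qed.

(** The Dirichlet form of v vanishes, hence each of its terms, so that v takes the
    same value at both ends of each link. *)
Lemma laplacian_kernel (v : 'I_n -> R) :
  (forall i, \sum_j laplacian A i j * v j = 0) -> forall i j, v i = v j.
Proof.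
move=> Lv; have [xi xi0 xiL] := laplacian_left_kernel.
have := laplacian_dirichlet v xiL.
under eq_bigr do rewrite Lv mulr0.
rewrite big1// => /esym/eqP; rewrite mulf_eq0 invr_eq0 pnatr_eq0/= => /eqP sum0.
have term0 i j : 0 <= xi i * A i j * (v i - v j) ^+ 2.
  by rewrite mulr_ge0 ?sqr_ge0// mulr_ge0// ltW.
apply: strongly_connected_ind => // [j i k -> //|i j ij].
move: sum0 => /(psumr_eq0P (fun i _ => sumr_ge0 _ (fun j _ => term0 i j))).
move=> /(_ j isT)/(psumr_eq0P (fun i _ => term0 j i))/(_ i isT)/eqP.
rewrite !mulf_eq0 orbb (gt_eqF (xi0 _)) (gt_eqF ij)/= subr_eq0 => /eqP.
by move->.
Qed.

(** The difference e_i - e_j of unit vectors annihilates the kernel of L, so it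
    lies in the row space of L. *)
Lemma laplacian_diff i j : exists D : 'I_n -> R, forall v : 'I_n -> R,
  v i - v j = \sum_k D k * \sum_l laplacian A k l * v l.
Proof.
have : ((delta_mx 0 i - delta_mx 0 j : ('rV_n)%type)%R <= laplacian A)%MS.
  have := mulmx_coker (laplacian A); rewrite submxE; move: (cokermx _) => C LC.
  apply/eqP/rowP => c; rewrite mulmxBl -!rowE !mxE; apply/eqP.
  rewrite subr_eq0; apply/eqP.
  apply: (laplacian_kernel (v := fun k => C k c)) => k.
  by have /matrixP/(_ k c) := LC; rewrite !mxE.
case/submxP => D ijD; exists (D 0) => v.
have -> : v i - v j = ((delta_mx 0 i - delta_mx 0 j : 'rV_n) *m \col_k v k) 0 0.
  by rewrite mulmxBl -!rowE !mxE.
rewrite ijD -mulmxA mxE; apply: eq_bigr => k _; rewrite mxE; congr (_ * _).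
by apply: eq_bigr => l _; rewrite [X in _ * X]mxE.
Qed.
End Laplacian.

(** * Saturated consensus under vanishing measurement errors *)

(** One coordinate of the closed loop: y_i are the true states, z_i the sampled
    ones, E bounds the measurement errors and G is a nonnegative primitive of
    - E, which turns the integral of E into a term of the Lyapunov function. The
    exceptional set F, finite on each bounded interval, collects the times at
    which the sampled values jump. *)
Section SaturatedConsensus.
Variables (R : realType) (n : nat) (A : 'M[R]_n) (h : R).
Variables (y z : 'I_n -> R -> R) (E G : R -> R).
Hypotheses (A0 : forall i j, 0 <= A i j) (sc : strongly_connected A) (h0 : 0 < h).

Let L := laplacian A.
Let u i t := - \sum_j L i j * y j t.
Let w i t := - \sum_j L i j * z j t.

Hypothesis yc : forall i, {within `[0, +oo[, continuous (y i)}.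
Hypothesis yd : forall b : R, exists F : seq R, forall t : R,
  0 < t < b -> t \notin F -> forall i,
    is_derive t 1 (y i) (sat h (w i t)) /\ `|z i t - y i t| <= E t.
Hypothesis G0 : forall t : R, 0 <= t -> 0 <= G t.
Hypothesis Gd : forall t : R, is_derive t 1 G (- E t).

Let segc (f : R -> R) a b : 0 <= a ->
  {within `[0, +oo[, continuous f} -> {within `[a, b], continuous f}.
Proof.
move=> a0; apply: continuous_subspaceW => t /=; rewrite !in_itv/= andbT.
by move=> /andP[+ _]; exact: le_trans.
Qed.

Let ylip i s t : 0 <= s -> s <= t -> `|y i t - y i s| <= h * (t - s).
Proof.
move=> s0 st; have [F yF] := yd t.
apply: (@lipschitz_finite _ _ _ F) => //; first exact: segc.
move=> r /andP[sr rt] rF; exists (sat h (w i r)); last exact: normr_sat_le.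
by have [] := yF r _ rF i; rewrite ?rt ?(le_lt_trans s0).
Qed.

Let C i := \sum_j `|L i j|.

Let ulip i s t : 0 <= s -> s <= t -> `|u i t - u i s| <= C i * h * (t - s).
Proof.
move=> s0 st; rewrite /u opprK addrC -sumrB (le_trans (ler_norm_sum _ _ _))//.
rewrite /C !mulr_suml; apply: ler_sum => j _.
rewrite -mulrBr normrM -mulrA ler_wpM2l// distrC; exact: ylip.
Qed.

Let werr i t e : (forall j, `|z j t - y j t| <= e) -> `|w i t - u i t| <= C i * e.
Proof.
move=> ze; rewrite /w /u opprK addrC -sumrB (le_trans (ler_norm_sum _ _ _))//.
rewrite /C !mulr_suml; apply: ler_sum => j _.
by rewrite -mulrBr normrM ler_wpM2l// distrC.
Qed.

Lemma saturated_consensus i j : y i t - y j t @[t --> +oo] --> (0 : R).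
Proof.
have [xi xi0 xiL] := laplacian_left_kernel A0 sc.
pose s i t := sat h (u i t).
pose K := \sum_i xi i * h * (\sum_j `|L i j| * C j).
(* K * E bounds the part of the derivative of the first sum that is due to the
   measurement errors, and K * G compensates it. *)
pose U t := \sum_i xi i * sat_potential h (u i t) + K * G t.
have U0 t : 0 <= t -> 0 <= U t.
  move=> t0; rewrite addr_ge0//.
    by apply: sumr_ge0 => k _; rewrite mulr_ge0 ?sat_potential_ge0// ltW.
  rewrite mulr_ge0 ?G0//; apply: sumr_ge0 => k _.
  rewrite mulr_ge0//; first by rewrite mulr_ge0// ltW.
  by apply: sumr_ge0 => l _; rewrite mulr_ge0// sumr_ge0.
have uc k : {within `[0, +oo[, continuous (u k)}.
  by move=> t; apply: continuousN; apply: cvg_lincomb => l; exact: yc.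
have Uc : {within `[0, +oo[, continuous U}.
  move=> t; apply: cvgD.
    apply: cvg_lincomb => k; apply: (continuous_comp (uc k t)).
    apply/differentiable_continuous/derivable1_diffP.
    exact: (@ex_derive _ _ _ _ _ _ _ (is_derive_sat_potential _ h0)).
  apply: cvgM; first exact: cvg_cst.
  apply: continuous_subspaceT => {}t.
  apply/differentiable_continuous/derivable1_diffP.
  exact: (@ex_derive _ _ _ _ _ _ _ (Gd t)).
have Ud b : exists F : seq R, forall t, 0 < t < b -> t \notin F ->
    exists2 d, is_derive t 1 U d &
      d <= - (2^-1 * \sum_i \sum_j xi i * A i j * (s i t - s j t) ^+ 2).
  have [F yF] := yd b; exists F => t tb tF.
  have {}yF k := yF t tb tF k.
  exists (\sum_i xi i * (s i t * - \sum_j L i j * sat h (w j t)) + K * - E t).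
    apply: (is_deriveD _ (is_deriveZ K (Gd t))).
    apply: is_derive_lincomb => k.
    apply: is_derive1_comp; first exact: is_derive_sat_potential.
    by apply: is_deriveN; apply: is_derive_lincomb => l; have [] := yF l.
  rewrite -laplacian_dirichlet//; set S := \sum_i _; set S' := \sum_i _.
  suff : S + S' <= K * E t by rewrite mulrN; lra.
  rewrite -big_split/= /K mulr_suml; apply: ler_sum => k _.
  have -> : xi k * (s k t * - \sum_j L k j * sat h (w j t)) +
      xi k * s k t * (\sum_j L k j * s j t) =
      - (xi k * (s k t * \sum_j L k j * (sat h (w j t) - s j t))).
    under [in RHS]eq_bigr do rewrite mulrBr.
    by rewrite sumrB; ring.
  rewrite (le_trans (ler_norm _))// normrN !normrM (ger0_norm (ltW (xi0 k))).
  rewrite -2!mulrA ler_pM2l// ler_pM//; first exact: normr_sat_le.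
  rewrite (le_trans (ler_norm_sum _ _ _))// mulr_suml; apply: ler_sum => l _.
  rewrite normrM -mulrA ler_wpM2l// (le_trans (sat_lipschitz _ _ h0))//.
  by apply: werr => m; have [] := yF m.
have slink k l : link A k l -> s k t - s l t @[t --> +oo] --> (0 : R).
  move=> kl.
  pose c := xi l * A l k / 2; pose l' := (C k + C l) * h + 1.
  apply: (@dissipation_vanishes _ U _ c l') => //.
  - by rewrite divr_gt0// mulr_gt0.
  - by rewrite ltr_wpDl// mulr_ge0 ?(ltW h0)// addr_ge0 ?sumr_ge0.
  - move=> a b a0 ab.
    have -> : s k b - s l b - (s k a - s l a) = (s k b - s k a) - (s l b - s l a).
      by ring.
    have := le_trans (sat_lipschitz _ _ h0) (ulip k a0 ab).
    have := le_trans (sat_lipschitz _ _ h0) (ulip l a0 ab).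
    move=> H1 H2; apply: (le_trans (ler_normB _ _)).
    have : 0 <= b - a by rewrite subr_ge0.
    rewrite /s /l'; lra.
  move=> a b e a0 ab e0 eg; have [F UF] := Ud b.
  apply: (@increment_le_finite _ _ _ F) => //; first exact: segc.
  move=> t /andP[at' tb] tF.
  have [|d Udt dle] := UF t _ tF; first by rewrite tb (le_lt_trans a0).
  exists d => //; apply: (le_trans dle); rewrite lerN2.
  (* Keep only the term of the link in the double sum. *)
  rewrite (bigD1 l)//= (bigD1 k)//= -[leLHS]addr0 -addrA mulrDr.
  rewrite lerD//.
    rewrite (_ : (s l t - s k t) ^+ 2 = (s k t - s l t) ^+ 2); last by ring.
    rewrite /c [leRHS]mulrC mulrAC ler_wpM2r// ler_wpM2l//.
      by rewrite mulr_ge0 ?ltW.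
    rewrite -[leRHS]real_normK ?num_real// lerXn2r ?nnegrE//.
    by rewrite eg// (ltW at') ltW.
  rewrite mulr_ge0// addr_ge0//.
    apply: sumr_ge0 => m _; rewrite mulr_ge0 ?sqr_ge0// mulr_ge0// ltW//.
  apply: sumr_ge0 => m _; apply: sumr_ge0 => r _.
  by rewrite mulr_ge0 ?sqr_ge0// mulr_ge0// ltW.
have sall : forall k l, s k t - s l t @[t --> +oo] --> (0 : R).
  apply: strongly_connected_ind sc _ _ slink => [k|l k m kl lm].
    by under eq_fun do rewrite subrr; exact: cvg_cst.
  have -> : (fun t => s k t - s m t) = (fun t => (s k t - s l t) + (s l t - s m t)).
    by apply/funext => t; ring.
  by rewrite -[X in _ --> X]addr0; apply: cvgD.
have usum t : \sum_k xi k * u k t = 0.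
  rewrite /u; under eq_bigr do rewrite mulrN mulr_sumr.
  rewrite sumrN exchange_big big1 ?oppr0// => k _.
  by under eq_bigr do rewrite mulrA; rewrite -mulr_suml xiL mul0r.
(* The weighted sum of the u_l being zero, some s_l has the sign opposite to
   that of s_k, or is zero. *)
have sle k t : `|s k t| <= \sum_l `|s k t - s l t|.
  have [l kl] : exists l, s k t * s l t <= 0.
    apply: contrapT => nex.
    have pos l : 0 < xi l * (s k t * u l t).
      rewrite mulr_gt0//; apply: (sat_mulr_gt0 h0); rewrite ltNge; apply/negP => ?.
      by apply: nex; exists l.
    suff : 0 < s k t * \sum_l xi l * u l t by rewrite usum mulr0 ltxx.
    rewrite mulr_sumr (eq_bigr (fun l => xi l * (s k t * u l t))); last first.
      by move=> l _; ring.
    by rewrite (bigD1 k)//= ltr_wpDr// sumr_ge0// => l _; exact: ltW.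
  rewrite (bigD1 l)//= ler_wpDr ?sumr_ge0//.
  rewrite -(@ler_pXn2r _ 2) ?nnegrE// !real_normK ?num_real//.
  by have := sqr_ge0 (s l t); rewrite sqrrB; lra.
have s0 k : s k t @[t --> +oo] --> (0 : R).
  apply: norm_cvg0; apply: (@squeeze_cvgr _ _ _ _ (cst 0)
    (fun t => \sum_l 1 * `|s k t - s l t|)).
  - near=> t; rewrite normr_ge0/=; under eq_bigr do rewrite mul1r.
    exact: sle.
  - exact: cvg_cst.
  - rewrite [X in _ --> X](_ : _ = \sum_(l < n) 1 * `|0 : R|); last first.
      by rewrite big1// => l _; rewrite normr0 mulr0.
    by apply: cvg_lincomb => l; apply: cvg_norm; exact: sall.
(* Below the level h saturation is the identity. *)
have u0 k : u k t @[t --> +oo] --> (0 : R).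
  apply: cvg_trans (s0 k); apply: near_eq_cvg.
  near=> t.
  have : `|s k t| < h by near: t; exact: (cvgr0_norm_lt _ (s0 k)).
  by rewrite ltr_norml /s; case: (sat_cases (u k t) h0) => -[? ->]; lra.
have [D DE] := laplacian_diff A0 sc i j.
have -> : (fun t => y i t - y j t) = (fun t => \sum_k D k * - u k t).
  apply/funext => t; rewrite (DE (y^~ t)); apply: eq_bigr => k _.
  by rewrite opprK.
rewrite [X in _ --> X](_ : _ = \sum_(k < n) D k * - 0); last first.
  by rewrite big1// => k _; rewrite oppr0 mulr0.
by apply: cvg_lincomb => k; apply: cvgN.
Unshelve. all: by end_near. Qed.

End SaturatedConsensus.

(** * Triggering times of one agent *)

Lemma enorm_sqr (R : realType) p (v : 'rV[R]_p) : enorm v ^+ 2 = \sum_c v 0 c ^+ 2.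
Proof. by rewrite sqr_sqrtr// sumr_ge0// => c _; exact: sqr_ge0. Qed.

Section Triggers.
Variables (R : realType) (p : nat) (a b : R) (y : R -> 'rV[R]_p) (T : nat -> \bar R).
Hypotheses (a0 : 0 < a) (yc : {within `[0, +oo[, continuous y}).
Hypothesis ev : event_rule a b y T.

(** At the next triggering time r the inequality of the rule cannot be strict: by
    continuity it would persist beyond r, which would not be the maximum. *)
Lemma threshold_reached k (s r : R) : 0 <= s -> T k = s%:E -> T k.+1 = r%:E ->
  s <= r /\ a * expR (- b * r) <= enorm (y s - y r) ^+ 2.
Proof.
move=> s0 Ts Tr; have [_ /(_ _ _ Ts) nxt _] := ev.
case: nxt => [[r' + [[sr adm] ub]]|[]]; rewrite Tr // => -[rr']; subst r'.
split=> //; rewrite leNgt; apply/negP => gtr.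
(* The squares are written as products with coefficient 1 so that the sum is
   literally a linear combination of continuous functions. *)
pose g t := a * expR (- b * t) -
  \sum_c 1 * ((y s 0 c - y t 0 c) * (y s 0 c - y t 0 c)).
have gE t : g t = a * expR (- b * t) - enorm (y s - y t) ^+ 2.
  rewrite /g enorm_sqr; congr (_ - _); apply: eq_bigr => c _.
  by rewrite mul1r -expr2 !mxE.
have gc : {within `[0, +oo[, continuous g}.
  move=> t; apply: cvgB.
    apply: cvgM; first exact: cvg_cst.
    apply: continuous_subspaceT => {}t.
    apply: (continuous_comp _ (@continuous_expR R _)).
    by apply: cvgM; [exact: cvg_cst|exact: cvg_id].
  apply: cvg_lincomb => c; apply: cvgM; apply: cvgB; try exact: cvg_cst;
    exact: within_continuous_coord.
have r0 : 0 <= r by exact: le_trans sr.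
have rD : `[0, +oo[%classic r by rewrite /= in_itv/= andbT.
have gr : 0 < g r by rewrite gE subr_gt0.
have : \forall t \near r, `[0, +oo[%classic t -> 0 < g t.
  exact: cvgr_gt _ ((subspace_continuousP _ _).1 gc r rD) _ gr.
move=> /nbhs_ballP[e /= e0 ge].
suff : r + e / 2 <= r by rewrite gerDl leNgt divr_gt0.
apply: ub; split=> [|t /andP[st te]].
  by rewrite (le_trans sr)// lerDl ltW// divr_gt0.
have [tr|rt] := leP t r; first by apply: adm; rewrite st.
rewrite -subr_ge0 -gE ltW// ge//=; last first.
  by rewrite in_itv/= andbT (le_trans s0).
by rewrite /ball/= distrC gtr0_norm ?subr_gt0//; lra.
Qed.

Lemma trigger_cases k : T k = +oo%E \/ exists2 s, 0 <= s & T k = s%:E.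
Proof.
have [T0 nxt Toy] := ev.
elim: k => [|k [/Toy->|[s s0 Ts]]]; first by right; exists 0.
  by left.
have [[r Tr _]|[-> _]] := nxt _ _ Ts; last by left.
right; exists r => //; have [sr _] := threshold_reached s0 Ts Tr.
exact: le_trans sr.
Qed.

(** The error is zero at a triggering time, whereas the threshold is positive. *)
Lemma trigger_lt k s : T k = s%:E -> (s%:E < T k.+1)%E.
Proof.
move=> Ts; have [|[r r0 Tr]] := trigger_cases k.+1; first by move->; rewrite ltry.
have s0 : 0 <= s.
  by have [|[s' s'0]] := trigger_cases k; rewrite Ts// => -[->].
have [sr] := threshold_reached s0 Ts Tr; rewrite Tr lte_fin lt_neqAle sr andbT.
apply: contraTneq => <-; rewrite subrr enorm_sqr big1; last first.
  by move=> c _; rewrite mxE expr0n.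
by rewrite leNgt negbK mulr_gt0 ?expR_gt0.
Qed.

Lemma trigger_nondecreasing : {homo T : k l / (k <= l)%N >-> (k <= l)%E}.
Proof.
apply: homo_leq => [//|k l m|k]; first exact: le_trans.
have [Ty|[s _ Ts]] := trigger_cases k; last by rewrite Ts ltW// trigger_lt.
by have [_ _ /(_ k Ty) ->] := ev; rewrite leey.
Qed.

Lemma last_trigger_exists t : 0 <= t -> (exists k, t%:E < T k)%E ->
  exists k, is_last_trigger T t k.
Proof.
move=> t0 ex; case: (ex_minnP ex) => -[|k] tk kmin.
  by case: ev tk => -> _ _; rewrite lte_fin ltNge t0.
exists k; split=> [|l Tl].
  by rewrite leNgt; apply/negP => /kmin; rewrite ltnn.
rewrite leqNgt; apply/negP => /trigger_nondecreasing kl.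
by have := lt_le_trans tk (le_trans kl Tl); rewrite ltxx.
Qed.

(** The next triggering time exceeds t, so t lies in the interval on which the
    rule controls the error; without a next triggering time these intervals are
    unbounded. *)
Lemma last_trigger_error t k : is_last_trigger T t k ->
  enorm (y (fine (T k)) - y t) ^+ 2 <= a * expR (- b * t).
Proof.
move=> [Tt lastk]; have [Ty|[s s0 Ts]] := trigger_cases k.
  by move: Tt; rewrite Ty leye_eq.
rewrite Ts lee_fin in Tt *; have [_ /(_ _ _ Ts) nxt _] := ev.
have tT : (t%:E < T k.+1)%E.
  by rewrite ltNge; apply/negP => /lastk; rewrite ltnn.
case: nxt => [[r Tr [[sr adm] _]]|[_ unb]].
  by apply: adm; rewrite Tt/= ltW// -lte_fin -Tr.
apply: contrapT => nle; apply: unb; exists t => r [sr adm].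
rewrite leNgt; apply/negP => tr; apply: nle; apply: adm.
by rewrite Tt ltW.
Qed.

End Triggers.

(** * The closed loop *)

Section ClosedLoopTheory.
Variables (R : realType) (n p : nat) (A : 'M[R]_n) (h : R) (alpha beta : 'I_n -> R).
Hypotheses (h0 : 0 < h) (alpha0 : forall i, 0 < alpha i).
Hypothesis beta0 : forall i, 0 < beta i.
Variables (x0 : 'I_n -> 'rV[R]_p) (x : 'I_n -> R -> 'rV[R]_p).
Variable T : 'I_n -> nat -> \bar R.
Hypothesis cl : closed_loop A h alpha beta x0 x T.

Let xc i : {within `[0, +oo[, continuous (x i)}.
Proof. by case: cl. Qed.

Let ev i : event_rule (alpha i) (beta i) (x i) (T i).
Proof. exact: cl_event cl i. Qed.

(** This excludes an accumulation of triggers at or before b while allowing an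
    agent to stop triggering, since the value +oo lies beyond b too. *)
Definition outrun (b : R) := forall j, exists k, (b%:E < T j k)%E.

Lemma outrun_le s t : s <= t -> outrun t -> outrun s.
Proof.
move=> st out j; have [k tk] := out j; exists k.
by apply: le_lt_trans tk; rewrite lee_fin.
Qed.

(** Finitely many triggers precede b, and off these the vector equation is read
    one coordinate at a time: in coordinate c the dynamics involves the
    coordinates c of the sampled states only. *)
Lemma coord_derive b : outrun b -> exists F : seq R, forall t, 0 < t < b ->
  t \notin F -> forall k, (forall j, is_last_trigger (T j) t (k j)) ->
  forall i c, is_derive t 1 (fun r => x i r 0 c)
    (sat h (- \sum_j laplacian A i j * x j (fine (T j (k j))) 0 c)).
Proof.
move=> out; have [K bK] := choice out.
exists [seq fine (T j l) | j <- enum 'I_n, l <- iota 0 (K j)].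
move=> t /andP[t0 tb] tF k klast i c.
have notT j l : T j l <> t%:E.
  move=> Tjl; apply: (negP tF); apply/allpairsPdep; exists j, l.
  rewrite mem_enum mem_iota add0n Tjl; split=> //=.
  rewrite ltnNge; apply/negP => /(trigger_nondecreasing (alpha0 j) (@xc j) (ev j)).
  rewrite Tjl => /(lt_le_trans (bK j)); rewrite lte_fin ltNge.
  by rewrite (ltW tb).
have xd := cl_ode cl t0 klast notT i.
have xd1 : derivable (x i) t 1 by case: xd.
have xd2 := derive_mx xd1; rewrite (@derive_val _ _ _ _ _ _ _ xd) in xd2.
have /rowP/(_ c) := xd2; rewrite !mxE => xd3.
split; first exact: (derivable_mxP _ _ _).1.
rewrite -xd3 summxE; congr (sat h (- _)); apply: eq_bigr => j _.
by rewrite mxE.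
Qed.

Lemma coord_lipschitz b i c s t : outrun b -> 0 <= s -> s <= t -> t <= b ->
  `|x i t 0 c - x i s 0 c| <= h * (t - s).
Proof.
move=> out s0 st tb; have [F xF] := coord_derive out.
apply: (@lipschitz_finite _ (fun r => x i r 0 c) _ F) => //.
  apply: within_continuous_coord; apply: continuous_subspaceW (@xc i).
  move=> r /=; rewrite !in_itv/= andbT => /andP[+ _]; exact: le_trans.
move=> r /andP[sr rt] rF.
have r0 : 0 < r by exact: le_lt_trans sr.
have rb : r < b by exact: lt_le_trans tb.
have lastr j : exists k, is_last_trigger (T j) r k.
  apply: (last_trigger_exists (alpha0 j) (@xc j) (ev j) (ltW r0)).
  exact: (outrun_le (ltW rb) out).
have [k klast] := choice lastr.
have := xF r _ rF k klast i c; rewrite r0 rb => /(_ isT) xr.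
by eexists; [exact: xr|exact: normr_sat_le].
Qed.

(** The error must climb from 0 to the threshold at speed at most h per
    coordinate. *)
Lemma trigger_gap i k s r : T i k = s%:E -> T i k.+1 = r%:E -> outrun r ->
  alpha i * expR (- beta i * r) <= p%:R * h ^+ 2 * (r - s) ^+ 2.
Proof.
move=> Ts Tr out.
have [|[s' s0]] := trigger_cases (@xc i) (ev i) k; rewrite Ts// => -[ss'].
subst s'.
have [sr] := threshold_reached (@xc i) (ev i) s0 Ts Tr; move/le_trans; apply.
rewrite enorm_sqr -mulrA -exprMn -[X in X%:R](card_ord p) mulr_natl -sumr_const.
apply: ler_sum => c _; rewrite !mxE.
rewrite -[leLHS]real_normK ?num_real//.
rewrite lerXn2r ?nnegrE// ?mulr_ge0 ?subr_ge0 ?(ltW h0)//.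
by rewrite distrC; exact: coord_lipschitz out s0 sr (lexx _).
Qed.

(** If triggers accumulate somewhere, take an agent i whose triggering times have
    the smallest supremum. As they increase strictly, each of them lies
    strictly below the supremum for every agent, so the gap estimate applies to
    all of them; the gaps are then at least Num.sqrt q and the triggering times
    of i are unbounded. *)
Lemma no_accumulation : forall t, outrun t.
Proof.
move=> t i0; apply: contrapT => nout.
pose sup j := ereal_sup (range (T j)).
have [i _ imin] := @arg_minP _ _ _ i0 predT sup isT.
have Tsup j k : (T j k <= sup j)%E by apply: ereal_sup_ubound; exists k.
have supt : (sup i <= t%:E)%E.
  apply: (le_trans (imin i0 isT)); apply: ge_ereal_sup => _ [k _ <-].
  by rewrite leNgt; apply/negP => tk; apply: nout; exists k.
have Tk k : exists s, T i k = s%:E /\ s <= t.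
  have [Ty|[s _ Ts]] := trigger_cases (@xc i) (ev i) k.
    by have := le_trans (Tsup i k) supt; rewrite Ty leye_eq.
  by exists s; split=> //; rewrite -lee_fin -Ts (le_trans (Tsup i k)).
have [s sE] := choice Tk.
have out k : outrun (s k).
  move=> j; apply: contrapT => nex.
  have : (sup j <= (s k)%:E)%E.
    apply: ge_ereal_sup => _ [l _ <-].
    by rewrite leNgt; apply/negP => tk; apply: nex; exists l.
  apply/negP; rewrite -ltNge.
  apply: (lt_le_trans (trigger_lt (alpha0 i) (@xc i) (ev i) (sE k).1)).
  exact: le_trans (imin j isT).
(* p.+1 instead of p avoids a division by zero in dimension 0. *)
pose q := alpha i * expR (- beta i * t) / (p.+1%:R * h ^+ 2).
have q0 : 0 < q by rewrite divr_gt0 ?mulr_gt0 ?expR_gt0 ?exprn_gt0.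
have gap k : s k + Num.sqrt q <= s k.+1.
  rewrite -lerBrDl; have sk : s k <= s k.+1.
    rewrite -lee_fin -(sE k).1 -(sE k.+1).1.
    exact: (trigger_nondecreasing (alpha0 i) (@xc i) (ev i)).
  rewrite -(@ler_pXn2r _ 2) ?nnegrE ?sqrtr_ge0 ?subr_ge0// sqr_sqrtr ?(ltW q0)//.
  rewrite /q ler_pdivrMr ?mulr_gt0 ?exprn_gt0//.
  have := trigger_gap (sE k).1 (sE k.+1).1 (out k.+1).
  have : alpha i * expR (- beta i * t) <= alpha i * expR (- beta i * s k.+1).
    rewrite ler_pM2l// ler_expR !mulNr lerN2 ler_pM2l//; exact: (sE _).2.
  move=> /le_trans H /H /le_trans; apply.
  by rewrite mulrC ler_wpM2l ?sqr_ge0// ler_wpM2r ?sqr_ge0// ler_nat.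
have low k : s 0%N + Num.sqrt q *+ k <= s k.
  elim: k => [|k IH]; first by rewrite mulr0n addr0.
  by apply: le_trans (gap k); rewrite mulrSr addrA lerD2r.
have s00 : s 0%N = 0 by have := (sE 0%N).1; case: (ev i) => -> _ _ [->].
have t0 : 0 <= t by rewrite -s00; exact: (sE _).2.
pose m := Num.bound (t / Num.sqrt q).
have := le_trans (low m) (sE m).2; rewrite s00 add0r leNgt => /negP; apply.
rewrite -mulr_natl -ltr_pdivrMr ?sqrtr_gt0//.
by apply: archi_boundP; rewrite divr_ge0// sqrtr_ge0.
Qed.

Lemma closed_loop_no_Zeno : no_Zeno T.
Proof.
move=> i a b; have [K bK] := no_accumulation b i.
apply: sub_finite_set (finite_II K) => k /= /andP[_ Tb].
rewrite ltnNge; apply/negP.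
move=> /(trigger_nondecreasing (alpha0 i) (@xc i) (ev i)).
by move=> /(lt_le_trans bK)/lt_le_trans/(_ Tb); rewrite ltxx.
Qed.

Hypotheses (A0 : forall i j, 0 <= A i j) (sc : strongly_connected A).

(** The square root of the error bound of the triggering rule, summed over the
    agents, serves as the E of [saturated_consensus]; being a sum of
    exponentials, - E has an explicit nonnegative primitive. *)
Lemma closed_loop_consensus : consensus x.
Proof.
move=> i j; apply: cvg_row0 => c.
have out := no_accumulation.
have last_ex : forall t : R, exists k : 'I_n -> nat,
    0 <= t -> forall j, is_last_trigger (T j) t (k j).
  move=> t; have [t0|_] := leP 0 t; last by exists (fun=> 0%N).
  suff /choice[k kP] : forall j, exists k, is_last_trigger (T j) t k by exists k.
  move=> l; apply: (last_trigger_exists (alpha0 l) (@xc l) (ev l)) => //.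
  exact: out.
have [k kP] := choice last_ex.
pose E (t : R) := \sum_l Num.sqrt (alpha l) * expR (- (beta l / 2) * t).
pose G (t : R) :=
  \sum_l (Num.sqrt (alpha l) * (2 / beta l)) * expR (- (beta l / 2) * t).
have -> : (fun t => (x i t - x j t) 0 c) = (fun t => x i t 0 c - x j t 0 c).
  by apply/funext => t; rewrite !mxE.
apply: (@saturated_consensus _ _ A h (fun l t => x l t 0 c)
  (fun l t => x l (fine (T l (k t l))) 0 c) E G) => //.
- by move=> l; apply: within_continuous_coord; exact: xc.
- move=> b; have [F xF] := coord_derive (out b).
  exists F => t tb tF l; have /andP[t0 _] := tb.
  have klast := kP t (ltW t0).
  split; first exact: xF.
  have := last_trigger_error (@xc l) (ev l) (klast l).
  rewrite enorm_sqr (bigD1 c)//= !mxE => /(le_trans _) err.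
  apply: (@le_trans _ _ (Num.sqrt (alpha l) * expR (- (beta l / 2) * t))).
    rewrite -(@ler_pXn2r _ 2) ?nnegrE ?mulr_ge0 ?sqrtr_ge0 ?expR_ge0//.
    rewrite real_normK ?num_real// exprMn sqr_sqrtr ?(ltW (alpha0 _))//.
    rewrite -expRM_natl (_ : 2 * (- (beta l / 2) * t) = - beta l * t); last by field.
    by apply: err; rewrite lerDl sumr_ge0// => ? _; exact: sqr_ge0.
  by rewrite /E (bigD1 l)//= lerDl sumr_ge0.
- move=> t t0; apply: sumr_ge0 => l _.
  by rewrite !mulr_ge0 ?sqrtr_ge0 ?expR_ge0// invr_ge0 ltW.
- move=> t.
  have -> : - E t = \sum_l (Num.sqrt (alpha l) * (2 / beta l)) *
      (expR (- (beta l / 2) * t) * (- (beta l / 2))).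
    rewrite /E -sumrN; apply: eq_bigr => l _; field.
    by rewrite gt_eqF.
  apply: is_derive_lincomb => l.
  apply: (is_derive1_comp (f := expR) (g := fun t => - (beta l / 2) * t)).
  rewrite -[X in is_derive _ _ _ X]mulr1.
  exact: (is_deriveZ (- (beta l / 2)) (is_derive_id t (1 : R))).
Qed.

End ClosedLoopTheory.

Theorem theorem3 (R : realType) (n p : nat) (A : 'M[R]_n) (h : R)
    (alpha beta : 'I_n -> R)
    (hA : weighted_adjacency A) (hsc : strongly_connected A) (hh : 0 < h)
    (halpha : forall i, 0 < alpha i) (hbeta : forall i, 0 < beta i) :
  forall (x0 : 'I_n -> 'rV[R]_p) (x : 'I_n -> R -> 'rV[R]_p)
         (T : 'I_n -> nat -> \bar R),
    closed_loop A h alpha beta x0 x T -> no_Zeno T /\ consensus x.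
Proof.
move=> x0 x T cl; split; first exact: closed_loop_no_Zeno cl.
exact: (closed_loop_consensus hh halpha hbeta cl hA.1 hsc).
Qed.
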